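(* Let $M$ be a real symmetric positive definite matrix of size $n$ and bandwidth $b$, with smallest and largest eigenvalues $\lambda_{\min}$ and $\lambda_{\max}$, and let $S=M\otimes I_n+I_n\otimes M$. For $k,t\in\{1,\ldots,n^2\}$ let $$j=\lfloor (t-1)/n\rfloor+1,\quad i=t-n\lfloor (t-1)/n\rfloor,\quad m=\lfloor (k-1)/n\rfloor+1,\quad \ell=k-n\lfloor (k-1)/n\rfloor .$$ Let $R=R(\omega)$ be the function of $\omega\in\mathbb{R}$ defined in the context. Then the following holds. (i) If $i\ne\ell$ and $j\ne m$, then $$|(S^{-1})_{k,t}|\le \frac{1}{2\pi}\,\frac{64}{|\lambda_{\max}-\lambda_{\min}|^2}\int_{-\infty}^{\infty}\left(\frac{R^2}{(R^2-1)^2}\right)^2\left(\frac1R\right)^{|i-\ell|/b+|j-m|/b-2}\,d\omega .$$ (ii) If either $i=\ell$ or $j=m$ (but not both), then $$|(S^{-1})_{k,t}|\le \frac{1}{2\pi}\,\frac{8}{|\lambda_{\max}-\lambda_{\min}|}\int_{-\infty}^{\infty}\frac{1}{\sqrt{\lambda_{\min}^2+\omega^2}}\,\frac{R^2}{(R^2-1)^2}\left(\frac1R\right)^{|i-\ell|/b+|j-m|/b-1}\,d\omega .$$ (iii) If both $i=\ell$ and $j=m$, then $$|(S^{-1})_{k,t}|\le \frac{1}{2\pi}\int_{-\infty}^{\infty}\frac{1}{\lambda_{\min}^2+\omega^2}\,d\omega=\frac{1}{2\lambda_{\min}} .$$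
   Context: $I_n$ is the $n\times n$ identity matrix and $\otimes$ is the Kronecker product. A symmetric matrix $A$ has bandwidth $b$ (is $b$-banded), $b\ge 1$, if $A_{ij}=0$ for $|i-j|>b$. For $\omega\in\mathbb{R}$ put $\lambda_1=\lambda_{\min}+\imath\omega$, $\lambda_2=\lambda_{\max}+\imath\omega$ (with $\imath^2=-1$), $$\alpha=\alpha(\omega)=\frac{|\lambda_1|+|\lambda_2|}{|\lambda_2-\lambda_1|},\qquad R=R(\omega)=\alpha+\sqrt{\alpha^2-1}>1 .$$ (The definition of $\alpha$ presupposes $\lambda_{\max}\neq\lambda_{\min}$.) *)

(* Defs.v *)
From mathcomp Require Import all_boot all_order all_algebra.
From mathcomp Require Import all_classical all_reals all_analysis.
From mathcomp Require Export complex mxtens.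
Set Implicit Arguments.
Unset Strict Implicit.
Unset Printing Implicit Defensive.
Import Order.TTheory GRing.Theory Num.Theory.
Import numFieldNormedType.Exports.
Local Open Scope ring_scope.
Local Open Scope complex_scope.

Definition posdef (R : realType) (n : nat) (M : 'M[R]_n) : Prop :=
  M^T = M /\ forall x : 'cV[R]_n, x != 0 -> 0 < (x^T *m M *m x) 0 0.

Definition banded (R : realType) (n b : nat) (M : 'M[R]_n) : Prop :=
  forall i j : 'I_n, b%:R < `|(i%:R : R) - j%:R| -> M i j = 0.

Definition smallest_eigenvalue (R : realType) (n : nat) (M : 'M[R]_n) (a : R) :
    Prop :=
  eigenvalue M a /\ forall c, eigenvalue M c -> a <= c.

Definition largest_eigenvalue (R : realType) (n : nat) (M : 'M[R]_n) (a : R) :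
    Prop :=
  eigenvalue M a /\ forall c, eigenvalue M c -> c <= a.

(* [tensmx A B] is the Kronecker product: its 0-based row index is
   [i1 * p + i2] for a row [i1] of [A] and a row [i2] of [B], where [p] is the
   number of rows of [B]. *)
Definition kron_sum (R : realType) (n : nat) (M : 'M[R]_n) : 'M[R]_(n * n) :=
  tensmx M 1%:M + tensmx 1%:M M.

(* The argument [s] ranges over the 1-based positions 1, ..., n^2, and the
   values are 1-based too. *)
Definition block_idx (n s : nat) : nat := ((s - 1) %/ n + 1)%N.
Definition inner_idx (n s : nat) : nat := (s - n * ((s - 1) %/ n))%N.

(* [ComplexField.Normc.normc] is the modulus with values in [R]; the generic
   norm of [R[i]] takes its values in [R[i]]. *)
Definition ellipse_alpha (R : realType) (lmin lmax w : R) : R :=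
  let l1 := lmin +i* w in
  let l2 := lmax +i* w in
  (ComplexField.Normc.normc l1 + ComplexField.Normc.normc l2)
    / ComplexField.Normc.normc (l2 - l1).

Definition ellipse_radius (R : realType) (lmin lmax w : R) : R :=
  let a := ellipse_alpha lmin lmax w in
  a + Num.sqrt (a ^+ 2 - 1).

(* Main.v *)
Require Import Defs.
From mathcomp Require Import all_boot all_order all_algebra.
From mathcomp Require Import all_classical all_reals all_analysis.
From mathcomp Require Import measurable_realfun.
From mathcomp Require Import ring lra.
Set Implicit Arguments.
Unset Strict Implicit.
Unset Printing Implicit Defensive.
Import Order.TTheory GRing.Theory Num.Theory.
Import numFieldNormedType.Exports.
Local Open Scope ring_scope.

(** Write [A(w) = M + i w]. For positive [a] and [c],
<<
    2 pi / (a + c) = \int Re (1 / ((a + i w) (c - i w))) dw,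
>>
    so, on decomposing [M] along its eigenvalues, [2 pi (S^-1)_(k, t)] is the
    integral over [w] of the real part of a product of one entry of [A(w)^-1],
    at the block indices of [k] and [t], and one conjugated entry of [A(w)^-1],
    at their inner indices. Each part of the proposition thus follows from
    pointwise bounds on entries of [A(w)^-1].

    The decomposition is [M = \sum_p d_p E_p], with [d_p] eigenvalues, the real
    matrices [E_p] summing to the identity, and [\sum_p |(E_p)_(k, l)| <= 1]
    for each entry (lemma [real_spectral_resolution]). An entry of [A(w)^-1] is
    then [\sum_p (E_p)_(k, l) / (d_p + i w)].

    - For every entry, [|d_p + i w| >= sqrt (lmin^2 + w^2)] gives the bound
      [1 / sqrt (lmin^2 + w^2)], which is the one used on the diagonal.
    - For [k <> l], the powers [M^r] with [r b < |k - l|] vanish at [(k, l)], so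
      subtracting from [1 / (x + i w)] any polynomial [q] of degree at most
      [(|k - l| - 1) / b] does not change the entry, which is therefore at most
      the error of [q] on the interval [lmin, lmax]. The pole [- i w] lies on the
      ellipse with foci [lmin] and [lmax] that the Joukowski map draws from the
      circle of radius [rho(w)] ([ellipse_radius_joukowski]); a truncated
      Chebyshev expansion of [1 / (x + i w)] with a corrected last coefficient
      has error at most
      [(2 / (lmax - lmin)) (4 rho^2 / (rho^2 - 1)^2) rho^(-m)] in degree [m]
      ([resolvent_poly_approx]). *)

(** * Polynomial approximation of a simple pole *)

(** For [w = t / z] and [w' = t^* / z] with [|t| = 1] these are the Chebyshev
    polynomials up to scaling. They exist because power sums obey the recurrence
    [s_(k+2) = (w + w') s_(k+1) - w w' s_k]. *)
Lemma power_sum_poly (K : comNzRingType) (u : {poly K}) (c : K) (k : nat) :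
  (size u <= 2)%N ->
  exists2 W : {poly K}, (size W <= k.+1)%N &
    forall x w w', w + w' = u.[x] -> w * w' = c -> W.[x] = w ^+ k + w' ^+ k.
Proof.
move=> su.
pose P k (W : {poly K}) := (size W <= k.+1)%N /\
  forall x w w', w + w' = u.[x] -> w * w' = c -> W.[x] = w ^+ k + w' ^+ k.
suff: exists W, P k W /\ exists W', P k.+1 W' by move=> [W [[]]]; exists W.
elim: k => [|k [W [[sW eW] [W' [sW' eW']]]]].
  exists 2%:R%:P; split; first split.
  - by rewrite size_polyC; case: eqP.
  - by move=> x w w' _ _; rewrite hornerC !expr0.
  - by exists u; split=> // x w w' <- _; rewrite !expr1.
exists W'; split; first by split.
exists (u * W' - c *: W); split.
- rewrite (leq_trans (size_polyD _ _))// size_polyN geq_max.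
  rewrite (leq_trans (size_polyMleq _ _)) /=; last first.
    by rewrite -subn1 leq_subLR (leq_trans (leq_add su sW')).
  by rewrite (leq_trans (size_scale_leq _ _))// (leq_trans sW)// !ltnS ltnW.
- move=> x w w' eu ec.
  rewrite hornerD hornerN hornerZ hornerM (eW _ _ _ eu ec) (eW' _ _ _ eu ec).
  by rewrite -eu -ec !exprS; ring.
Qed.

(** The map [w |-> w / (1 - w)] sends the circle [|w| = 1 / |z|] to a circle
    centred at [1 / (|z|^2 - 1)], so subtracting the centre makes the modulus
    constant, and as small as subtracting a constant can. *)
Lemma norm_recentred_pole (C : numClosedFieldType) (w z : C) :
  1 < `|z| -> `|w| = `|z|^-1 ->
  `|w / (1 - w) - (`|z| ^+ 2 - 1)^-1| = `|z| / (`|z| ^+ 2 - 1).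
Proof.
move=> z1 ew.
have z0 : 0 < `|z| by rewrite (lt_trans ltr01).
have w_lt1 : `|w| < 1 by rewrite ew invf_lt1.
have w1 : 1 - w != 0.
  by rewrite subr_eq0; apply: contraTneq w_lt1 => <-; rewrite normr1 ltxx.
have d0 : 0 < `|z| ^+ 2 - 1 by rewrite subr_gt0 exprn_cp1.
have ew2 : w * w^* = `|z| ^- 2 by rewrite -normCK ew exprVn.
have -> : w / (1 - w) - (`|z| ^+ 2 - 1)^-1 =
    (w * (1 - w^*)) / (1 - w) * (`|z| ^+ 2 / (`|z| ^+ 2 - 1)).
  rewrite mulrBr ew2 mulr1; field.
  by rewrite w1 !(gt_eqF, d0, z0).
rewrite !normrM normfV ew -(norm_conjC (1 - w)) rmorphB rmorph1 /=.
rewrite mulfK ?normr_eq0; last by rewrite -[1]conjC1 -rmorphB conjC_eq0.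
rewrite !normfV (gtr0_norm d0) !normr_id.
by field; rewrite !gt_eqF.
Qed.

Lemma unit_circle_lift (C : numClosedFieldType) (y : C) : -1 <= y <= 1 ->
  exists2 t : C, t * t^* = 1 & t + t^* = 2 * y.
Proof.
move=> /andP[yN y1].
have yR : y^* = y by apply: CrealP; rewrite -(ler_real yN) rpredN rpred1.
have s0 : 0 <= 1 - y ^+ 2.
  have -> : 1 - y ^+ 2 = (1 - y) * (y - (-1)) by ring.
  by rewrite mulr_ge0 ?subr_ge0.
have sR : (sqrtC (1 - y ^+ 2))^* = sqrtC (1 - y ^+ 2).
  by apply: CrealP; rewrite realE sqrtC_ge0 s0.
exists (y + 'i * sqrtC (1 - y ^+ 2)); rewrite rmorphD rmorphM /= conjCi yR sR.
  rewrite mulNr mulrC -subr_sqr exprMn sqrtCK sqrCi; ring.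
by ring.
Qed.

(** Scale the interval to [-1, 1] by [x = c + h y] and write [2 y = t + t^*] with
    [|t| = 1], [w = t / z], [w' = t^* / z]. Then the pole expands as
    [K (1 + \sum_(j >= 1) (w^j + w'^j))] with [K = - 2 / (h (z - 1 / z))]. Plain
    truncation at [j = m] leaves [K (w^m g(w) + w'^m g(w'))] with
    [g(w) = w / (1 - w)]; adding [dl = 1 / (|z|^2 - 1)] times the last term
    recentres [g] and lowers its bound from [1 / (|z| - 1)] to
    [|z| / (|z|^2 - 1)] ([norm_recentred_pole]). *)
Lemma resolvent_poly_approx (C : numClosedFieldType) (z c h : C) (m : nat) :
  0 < h -> 1 < `|z| ->
  exists2 q : {poly C}, (size q <= m.+1)%N &
    forall x : C, c - h <= x <= c + h ->
      `|(x - c - h * (z + z^-1) / 2)^-1 - q.[x]| <=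
      h^-1 * (4 * `|z| ^+ 2 / (`|z| ^+ 2 - 1) ^+ 2) * `|z| ^- m.
Proof.
move=> h0 z1.
have hN0 : h != 0 by rewrite gt_eqF.
have z0 : 0 < `|z| by rewrite (lt_trans ltr01).
have zN0 : z != 0 by rewrite -normr_gt0.
have d0 : 0 < `|z| ^+ 2 - 1 by rewrite subr_gt0 exprn_cp1.
pose u : {poly C} := (2 / (h * z)) *: ('X - c%:P).
have su : (size u <= 2)%N.
  by rewrite (leq_trans (size_scale_leq _ _))// size_XsubC.
pose T k := sval (cid2 (power_sum_poly (z ^- 2) k su)).
have sT k : (size (T k) <= k.+1)%N by rewrite /T; case: cid2.
have eT k x w w' : w + w' = u.[x] -> w * w' = z ^- 2 ->
    (T k).[x] = w ^+ k + w' ^+ k.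
  by rewrite /T; case: cid2 => //= W _; apply.
pose K : C := - 2 / (h * (z - z^-1)).
pose dl : C := (`|z| ^+ 2 - 1)^-1.
exists (K *: (1 + \sum_(j < m) T j.+1 + dl *: T m)).
  rewrite (leq_trans (size_scale_leq _ _))// (leq_trans (size_polyD _ _))//.
  rewrite geq_max (leq_trans (size_scale_leq _ _))// andbT.
  rewrite (leq_trans (size_polyD _ _))// geq_max size_poly1 /=.
  apply: (big_ind (fun p : {poly C} => (size p <= m.+1)%N)).
  - by rewrite size_poly0.
  - by move=> p p' sp sp'; rewrite (leq_trans (size_polyD _ _))// geq_max sp.
  - by move=> j _; rewrite (leq_trans (sT _))// ltnS.
move=> x /andP[xl xr].
have [|t tt tD] := @unit_circle_lift C ((x - c) / h).
  by rewrite ler_pdivlMr// ler_pdivrMr// mulN1r mul1r lerBrDr addrC xl lerBlDl.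
have t1 : `|t| = 1 by apply/eqP; rewrite -sqrp_eq1// normCK tt.
pose w := t / z; pose w' := t^* / z.
have wD : w + w' = u.[x].
  by rewrite /u !hornerE -mulrDl tD; field; rewrite zN0 hN0.
have wM : w * w' = z ^- 2 by rewrite /w /w' mulrACA tt mul1r -invfM.
have nw : `|w| = `|z|^-1 by rewrite normrM t1 mul1r normfV.
have nw' : `|w'| = `|z|^-1 by rewrite normrM norm_conjC t1 mul1r normfV.
have neq1 (v : C) : `|v| = `|z|^-1 -> 1 - v != 0.
  move=> nv; rewrite subr_eq0; apply: contraTneq z1 => v1.
  by rewrite -(invrK `|z|) -nv -v1 normr1 invr1 ltxx.
have geom (v : C) : 1 - v != 0 ->
    \sum_(j < m) v ^+ j.+1 = v / (1 - v) - v ^+ m * (v / (1 - v)).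
  move=> v1; elim: (m) => [|k IH]; first by rewrite big_ord0 expr0; ring.
  by rewrite big_ord_recr IH /= exprS; field.
have zz : z - z^-1 != 0.
  rewrite subr_eq0; apply: contraTneq z1 => zV.
  have /eqP : `|z| ^+ 2 = 1 by rewrite -normrX expr2 {2}zV mulfV// normr1.
  by rewrite sqrp_eq1 ?normr_ge0// => /eqP->; rewrite ltxx.
(* The pole factors through [y - (z + 1 / z) / 2 = - (z / 2) (1 - w) (1 - w')]. *)
have -> : (x - c - h * (z + z^-1) / 2)^-1 =
    K * (1 + w / (1 - w) + w' / (1 - w')).
  have := neq1 _ nw'; have := neq1 _ nw => w1 w1'.
  have -> : 1 + w / (1 - w) + w' / (1 - w') =
      (1 - w * w') / (1 + w * w' - (w + w')).
    field; rewrite w1 w1' !andbT.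
    have -> : 1 + w * w' - (w + w') = (1 - w) * (1 - w') by ring.
    exact: mulf_neq0.
  have := mulf_neq0 w1 w1'.
  have -> : (1 - w) * (1 - w') = 1 + w * w' - (w + w') by ring.
  rewrite wM wD /u !hornerE => D0.
  rewrite /K.
  have D1 : x - c - h * (z + z^-1) / 2 != 0.
    apply: contraNneq D0 => /(congr1 ( *%R (2 / (h * z)))).
    rewrite mulr0 => E; apply/eqP; rewrite -[RHS]oppr0 -E; field.
    by rewrite zN0 hN0.
  rewrite /=; set D := 1 + z ^- 2 - 2 / (h * z) * (x - c) in D0 *.
  have -> : x - c - h * (z + z^-1) / 2 = - (h * z / 2) * D.
    by rewrite /D; field; rewrite zN0 hN0.
  have zz2 : z * z - 1 != 0.
    have -> : z * z - 1 = z * (z - z^-1) by field.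
    exact: mulf_neq0.
  by field; rewrite D0 zN0 zz2 hN0.
rewrite hornerZ !hornerD horner_sum hornerZ -mulrBr (eT _ _ _ _ wD wM).
rewrite (eq_bigr (fun j : 'I_m => w ^+ j.+1 + w' ^+ j.+1)); last first.
  by move=> j _; rewrite (eT _ _ _ _ wD wM).
rewrite big_split /= !geom ?neq1// hornerC.
set g := w / (1 - w); set g' := w' / (1 - w').
have -> : 1 + g + g' - (1 + (g - w ^+ m * g + (g' - w' ^+ m * g')) +
    dl * (w ^+ m + w' ^+ m)) = w ^+ m * (g - dl) + w' ^+ m * (g' - dl) by ring.
have K_le : `|K| <= 2 / (h * (`|z| - `|z|^-1)).
  rewrite /K normrM normrN normr_nat normfV normrM (gtr0_norm h0).
  have ? : 0 < `|z| - `|z|^-1 by rewrite subr_gt0 (lt_trans _ z1)// invf_lt1.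
  rewrite ler_pM2l ?ltr0n// lef_pV2 ?posrE ?mulr_gt0 ?normr_gt0//.
  by rewrite ler_pM2l// -normfV lerB_dist.
rewrite normrM.
apply: (@le_trans _ _ (2 / (h * (`|z| - `|z|^-1)) *
    (2 * (`|z| ^- m * (`|z| / (`|z| ^+ 2 - 1)))))).
  apply: ler_pM => //; rewrite (le_trans (ler_normD _ _))// !normrM !normrX.
  by rewrite !norm_recentred_pole// nw nw' !exprVn mulr2n mulrDl mul1r.
rewrite le_eqVlt; apply/orP; left; apply/eqP; field.
by rewrite hN0 !gt_eqF ?exprn_gt0.
Qed.

(** * Spectral resolution of a real symmetric matrix *)

Section SpectralResolution.
Local Open Scope sesquilinear_scope.

Lemma eigenvalue_map_complex (R : realType) (n : nat) (M : 'M[R]_n) (a : R) :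
  eigenvalue (map_mx (real_complex R) M) (real_complex R a) = eigenvalue M a.
Proof. by rewrite !eigenvalue_root_char -map_char_poly fmorph_root. Qed.

(** Diagonalise [M = P^* D P] with [P] unitary over the complex numbers, and let
    [E_p] be the real part of the rank-one matrix [P^* e_p e_p^T P]. As [M] and
    its eigenvalues are real, taking real parts keeps [M E_p = d_p E_p] and
    [\sum_p E_p = 1]. The entrywise bound is the inequality
    [2 |a| |b| <= |a|^2 + |b|^2] summed over two columns of [P], which have norm
    one. *)
Lemma real_spectral_resolution (R : realType) (n : nat) (M : 'M[R]_n) :
  M^T = M ->
  exists (d : 'I_n -> R) (E : 'I_n -> 'M[R]_n),
  [/\ forall p, eigenvalue M (d p),
      forall p, M *m E p = d p *: E p,
      \sum_p E p = 1%:M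
    & forall k l, \sum_p `|E p k l| <= 1].
Proof.
move=> Msym; pose A : 'M[R[i]]_n := map_mx (real_complex R) M.
have Aherm : A \is hermsymmx.
  apply: realsym_hermsym.
    apply/is_hermitianmxP; rewrite expr0 scale1r map_mx_id//.
    by apply/matrixP => k l; rewrite !mxE -[in LHS]Msym mxE.
  by apply/mxOverP => k l; rewrite mxE complex_real.
pose P := spectralmx A; pose D := spectral_diag A.
have PU : P \is unitarymx := spectral_unitarymx A.
have AE : A = P^t* *m diag_mx D *m P.
  rewrite -invmx_unitary//; apply/orthomx_spectralP.
  exact: hermitian_normalmx.
have PP : P^t* *m P = 1%:M by apply: mulmx1C; exact/unitarymxP.
pose d p := complex.Re (D 0 p).
have dE p : D 0 p = real_complex R (d p).
  by rewrite RRe_real//; apply: (mxOverP (hermitian_spectral_diag_real Aherm)).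
pose F p : 'M[R[i]]_n := col p (P^t*) *m row p P.
have FE p k l : F p k l = (P p k)^* * P p l.
  by rewrite !mxE big_ord1 !mxE.
have AF p : A *m F p = real_complex R (d p) *: F p.
  have AP : A *m P^t* = P^t* *m diag_mx D.
    by rewrite AE mulmxtVK.
  rewrite /F [in LHS]colE !mulmxA AP -colE -dE scalemxAl; congr (_ *m _).
  by apply/colP => k; rewrite mxE mul_mx_diag !mxE mulrC.
have F1 : \sum_p F p = 1%:M.
  by rewrite -PP; apply/matrixP => k l; rewrite summxE mxE;
     apply: eq_bigr => p _; rewrite FE !mxE.
have col1 k : \sum_p `|P p k| ^+ 2 = 1.
  have /matrixP/(_ k k) := PP; rewrite !mxE eqxx; apply: etrans.
  by apply: eq_bigr => p _; rewrite normCK !mxE mulrC.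
exists d, (fun p => map_mx (@complex.Re R) (F p)); split.
- move=> p; rewrite -eigenvalue_map_complex -/A; apply/eigenvalueP.
  exists (row p P).
    rewrite AE -!mulmxA -row_mul (mulmxA P) (unitarymxP _)// mul1mx.
    by apply/rowP => k; rewrite mul_diag_mx !mxE dE.
  apply/eqP => P0; have /matrixP/(_ p p) := unitarymxP PU.
  rewrite !mxE eqxx big1 => [/esym/eqP|k _]; first by rewrite oner_eq0.
  by have /rowP/(_ k) := P0; rewrite !mxE => ->; rewrite mul0r.
- move=> p; apply/matrixP => k l; have /matrixP/(_ k l) := AF p.
  rewrite [LHS]mxE [RHS]mxE => /(congr1 (@complex.Re R)).
  rewrite raddf_sum /= => ER.
  rewrite [LHS]mxE [RHS]mxE [X in _ * X]mxE.
  transitivity (complex.Re (real_complex R (d p) * F p k l)).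
    rewrite -ER; apply: eq_bigr => q _; rewrite [in LHS]mxE [A k q]mxE.
    by case: (F p q l) => x y /=; rewrite mul0r subr0.
  by case: (F p k l) => x y /=; rewrite mul0r subr0.
- apply/matrixP => k l; have /matrixP/(_ k l) := F1.
  rewrite !summxE => /(congr1 (@complex.Re R)); rewrite raddf_sum /= !mxE => E1.
  transitivity (complex.Re (k == l)%:R : R); last by case: eqP.
  by rewrite -E1; apply: eq_bigr => p _; rewrite [LHS]mxE.
- move=> k l.
  have : \sum_p `|F p k l| <= 1 :> R[i].
    apply: (@le_trans _ _ (\sum_p (`|P p k| ^+ 2 + `|P p l| ^+ 2) / 2)).
      apply: ler_sum => p _; rewrite FE normrM norm_conjC ler_pdivlMr ?ltr0n//.
      rewrite -subr_ge0.
      have -> : `|P p k| ^+ 2 + `|P p l| ^+ 2 - `|P p k| * `|P p l| * 2 =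
        (`|P p k| - `|P p l|) ^+ 2 by ring.
      by rewrite real_exprn_even_ge0// rpredB// normr_real.
    by rewrite -mulr_suml big_split /= !col1 -mulr2n divff.
  move=> H; rewrite -lecR rmorph_sum /=; apply: le_trans H.
  apply: ler_sum => p _.
  rewrite mxE normc_def lecR -sqrtr_sqr ler_sqrt ?addr_ge0 ?sqr_ge0//.
  by rewrite lerDl sqr_ge0.
Qed.
End SpectralResolution.

(** * The integral over the imaginary shift *)

Section LorentzIntegrals.
Context {R : realType}.
Notation mu := (@lebesgue_measure R).

Lemma sum_sqr_gt0 (a w : R) : 0 < a -> 0 < a ^+ 2 + w ^+ 2.
Proof. by move=> a0; rewrite ltr_wpDr ?sqr_ge0// exprn_gt0. Qed.

Lemma continuous_sum_sqr (a : R) : continuous (fun w : R => a ^+ 2 + w ^+ 2).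
Proof.
by move=> w; apply: cvgD; [exact: cvg_cst|exact: exprn_continuous].
Qed.

Lemma continuous_lorentz (a : R) : 0 < a ->
  continuous (fun w : R => a / (a ^+ 2 + w ^+ 2)).
Proof.
move=> a0 w; apply: cvgM; first exact: cvg_cst.
apply: cvgV; last exact: continuous_sum_sqr.
by rewrite gt_eqF// sum_sqr_gt0.
Qed.

Lemma integral_lorentz (a : R) : 0 < a ->
  (\int[mu]_w (a / (a ^+ 2 + w ^+ 2))%:E = (pi : R)%:E)%E.
Proof.
move=> a0.
have f0 w : 0 <= a / (a ^+ 2 + w ^+ 2) by rewrite divr_ge0 ?ltW// sum_sqr_gt0.
have dF (w : R) :
    is_derive w 1 (fun x => atan (a^-1 * x)) (a / (a ^+ 2 + w ^+ 2)).
  have -> : a / (a ^+ 2 + w ^+ 2) = (1 + (a^-1 * w) ^+ 2)^-1 * (a^-1 *: 1).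
    rewrite scaler1; field.
    by rewrite gt_eqF// !gt_eqF ?sum_sqr_gt0.
  exact: (@is_derive1_comp _ atan (fun x => a^-1 * x)).
have cF (w : R) : {for w, continuous (fun x => atan (a^-1 * x))}.
  apply: differentiable_continuous; apply/derivable1_diffP.
  exact: ex_derive.
rewrite ge0_symfun_integralT//; last 2 first.
- exact: continuous_lorentz.
- by move=> w /=; rewrite sqrrN.
rewrite -set_itvcy.
rewrite (@ge0_continuous_FTC2y _ _ (fun x => atan (a^-1 * x)) 0 (pi / 2)).
- by rewrite mulr0 atan0 sube0 -EFinM mulrC divfK.
- by [].
- exact/continuous_subspaceT/continuous_lorentz.
- apply: (@cvg_comp _ _ _ (fun x => a^-1 * x) atan _ (pinfty_nbhs R)).
    by apply: gt0_cvgMry; [rewrite invr_gt0|].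
  exact: cvgy_atan.
- by move=> w _; exact: ex_derive.
- by apply: cvg_at_right_filter; exact: cF.
- by move=> w _; rewrite derive1E; exact: derive_val.
Qed.

Lemma integrable_lorentz (a : R) : 0 < a ->
  mu.-integrable setT (fun w => (a / (a ^+ 2 + w ^+ 2))%:E).
Proof.
move=> a0; apply/integrableP; split.
  by apply/measurable_EFinP; apply: continuous_measurable_fun;
     exact: continuous_lorentz.
under eq_integral.
  move=> w _.
  by rewrite abse_EFin ger0_norm ?divr_ge0 ?ltW ?sum_sqr_gt0//; over.
by rewrite integral_lorentz// ltry.
Qed.

(** The left-hand side is [Re (1 / ((a + i w) (c - i w)))]. *)
Lemma resolvent_pair_partial_fraction (a c w : R) : 0 < a -> 0 < c ->
  (a * c + w ^+ 2) / ((a ^+ 2 + w ^+ 2) * (c ^+ 2 + w ^+ 2)) =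
  (a + c)^-1 * (a / (a ^+ 2 + w ^+ 2) + c / (c ^+ 2 + w ^+ 2)).
Proof.
move=> a0 c0; field.
by rewrite !gt_eqF ?sum_sqr_gt0// addr_gt0.
Qed.

Lemma integral_resolvent_pair (a c : R) : 0 < a -> 0 < c ->
  let f w := ((a * c + w ^+ 2) / ((a ^+ 2 + w ^+ 2) * (c ^+ 2 + w ^+ 2)))%:E in
  mu.-integrable setT f /\ (\int[mu]_w f w = (2 * pi / (a + c))%:E)%E.
Proof.
move=> a0 c0 /=.
have ia := integrable_lorentz a0; have ic := integrable_lorentz c0.
have iac : mu.-integrable setT (fun w => ((a / (a ^+ 2 + w ^+ 2))%:E +
    (c / (c ^+ 2 + w ^+ 2))%:E)%E) by apply: integrableD.
have -> : (fun w => ((a * c + w ^+ 2) /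
      ((a ^+ 2 + w ^+ 2) * (c ^+ 2 + w ^+ 2)))%:E) =
    (fun w => ((a + c)^-1)%:E * ((a / (a ^+ 2 + w ^+ 2))%:E +
      (c / (c ^+ 2 + w ^+ 2))%:E))%E.
  by apply/funext => w; rewrite resolvent_pair_partial_fraction// EFinM EFinD.
split; first exact: integrableZl.
rewrite integralZl// integralD// !integral_lorentz//.
by rewrite -EFinD -EFinM; congr (_%:E); ring.
Qed.
End LorentzIntegrals.

(** * The ellipse through the shifted spectrum *)

(** The two preimages of [a] under [z |-> (z + 1 / z) / 2] are mutually inverse,
    so one of them lies outside the open unit disc. The last equation says that
    [a] is on the ellipse with foci [1] and [-1] whose semi-axes sum to [|z|]; it
    is the parallelogram law applied to
    [a - 1 = (z - 1)^2 / (2 z)] and [a + 1 = (z + 1)^2 / (2 z)]. *)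
Lemma joukowski_preimage (C : numClosedFieldType) (a : C) :
  exists z : C, [/\ 1 <= `|z|, z + z^-1 = 2 * a
    & `|a - 1| + `|a + 1| = `|z| + `|z|^-1].
Proof.
suff [z [z1 az]] : exists z : C, 1 <= `|z| /\ z + z^-1 = 2 * a.
  exists z; split=> //.
  have z0 : z != 0 by rewrite -normr_gt0 (lt_le_trans ltr01).
  have -> : a - 1 = (z - 1) ^+ 2 / (2 * z).
    by apply: (@mulfI _ 2); [rewrite pnatr_eq0|rewrite mulrBr -az; field].
  have -> : a + 1 = (z + 1) ^+ 2 / (2 * z).
    by apply: (@mulfI _ 2); [rewrite pnatr_eq0|rewrite mulrDr -az; field].
  rewrite ![`|_ / _|]normrM !normfV !normrX normrM normr_nat -mulrDl.
  have -> : `|z - 1| ^+ 2 + `|z + 1| ^+ 2 = 2 * (`|z| ^+ 2 + 1).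
    by rewrite !normCK rmorphB rmorphD rmorph1; ring.
  by field; rewrite normr_eq0.
pose s := sqrtC (a ^+ 2 - 1).
have ss : s ^+ 2 = a ^+ 2 - 1 by rewrite sqrtCK.
have zz : (a + s) * (a - s) = 1 by rewrite mulrC -subr_sqr ss; ring.
have z0 : a + s != 0.
  by apply: contra_eq_neq zz => ->; rewrite mul0r eq_sym oner_eq0.
have zV : (a + s)^-1 = a - s by rewrite -[LHS]mulr1 -zz mulKf.
have [z1|z1] := real_leP (real1 C) (normr_real (a + s)).
  by exists (a + s); split=> //; rewrite zV; ring.
exists (a - s); split; last by rewrite -zV invrK zV; ring.
by rewrite -zV normfV invf_ge1 ?normr_gt0// ltW.
Qed.

Section Complex.
Context {R : realType}.
Local Open Scope complex_scope.
Notation normc := (@ComplexField.Normc.normc R).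

Lemma normcR_def (z : R[i]) : `|z| = (normc z)%:C.
Proof. by case: z. Qed.

(** In the coordinate [y] with [x = c + h y], the pole [x = - i w] becomes
    [a = - (c + i w) / h], and [|a - 1| + |a + 1|] is twice [ellipse_alpha].
    Hence [ellipse_alpha] is [(r + 1 / r) / 2] for the modulus [r >= 1] of the
    Joukowski preimage of [a], which makes [ellipse_radius] equal to [r]. It
    exceeds one because [|c - h + i w| + |c + h + i w| >= 2 c > 2 h]. *)
Lemma ellipse_radius_joukowski (c h w : R) : 0 < h -> h < c ->
  let rho := ellipse_radius (c - h) (c + h) w in
  1 < rho /\ exists z : R[i], `|z| = rho%:C /\
    c%:C + h%:C * (z + z^-1) / 2 = - (w *i).
Proof.
move=> h0 hc rho.
have c0 : 0 < c := lt_trans h0 hc.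
have hC0 : h%:C != 0 by rewrite fmorph_eq0 gt_eqF.
have nR (x : R) : 0 < x -> normc x%:C = x.
  by move=> x0; rewrite /= expr0n addr0 sqrtr_sqr gtr0_norm.
pose a : R[i] := - (c +i* w) / h%:C.
have [z [z1 za zn]] := joukowski_preimage a.
pose r : R := normc z.
have rE : `|z| = r%:C by rewrite normcR_def.
have r1 : 1 <= r by rewrite -lecR -rE.
have r0 : 0 < r by rewrite (lt_le_trans ltr01).
have na (b x : R) : x = c - h * b ->
    `|a + b%:C| = (normc (x +i* w) / h)%:C.
  move=> ->; have -> : a + b%:C = - (((c - h * b) +i* w) / h%:C).
    apply: (mulIf hC0); rewrite /a mulrDl !mulNr !divfK//.
    by simpc; congr (_ +i* _); ring.
  by rewrite normrN normrM normfV !normcR_def nR// rmorphM fmorphV.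
have alphaE : ellipse_alpha (c - h) (c + h) w =
    (normc ((c - h) +i* w) + normc ((c + h) +i* w)) / (2 * h).
  rewrite /ellipse_alpha.
  have -> : (c + h) +i* w - ((c - h) +i* w) = (2 * h)%:C.
    by simpc; congr (_ +i* _); ring.
  by rewrite nR// mulr_gt0.
have alpha_r : ellipse_alpha (c - h) (c + h) w = (r + r^-1) / 2.
  suff : r + r^-1 = (normc ((c + h) +i* w) + normc ((c - h) +i* w)) / h.
    by rewrite alphaE => ->; field; rewrite gt_eqF.
  apply: complexI; rewrite mulrDl !rmorphD fmorphV /= -rE -zn.
  congr (_ + _).
    by rewrite -(na (- 1)) ?rmorphN ?rmorph1//; ring.
  by rewrite -(na 1) ?rmorph1//; ring.
have rhoE : rho = r.
  rewrite /rho /ellipse_radius alpha_r.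
  have -> : ((r + r^-1) / 2) ^+ 2 - 1 = ((r - r^-1) / 2) ^+ 2.
    by field; rewrite gt_eqF.
  rewrite sqrtr_sqr ger0_norm; first by field; rewrite gt_eqF.
  by rewrite divr_ge0// subr_ge0 (le_trans _ r1)// invf_le1.
split; last first.
  exists z; split; first by rewrite rE rhoE.
  rewrite za /a.
  have -> : h%:C * (2 * (- (c +i* w) / h%:C)) / 2 = - (c +i* w) by field.
  by simpc; congr (_ +i* _); ring.
rewrite rhoE lt_neqAle r1 andbT; apply/eqP => req.
have norm_ge (x : R) : 0 < x -> x <= normc (x +i* w).
  move=> x0; rewrite -{1}(gtr0_norm x0) -sqrtr_sqr ler_wsqrtr//.
  by rewrite lerDl sqr_ge0.
have ch0 : 0 < c - h by rewrite subr_gt0.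
have ch0' : 0 < c + h by rewrite addr_gt0.
have := lerD (norm_ge _ ch0) (norm_ge _ ch0').
move: alphaE; rewrite alpha_r -req invr1 => /(congr1 (fun x => x * (2 * h))).
rewrite divfK ?mulf_neq0 ?gt_eqF// => <-.
by move: hc; lra.
Qed.
End Complex.

Lemma ellipse_radius_gt1 (R : realType) (lmin lmax w : R) :
  0 < lmin -> lmin < lmax -> 1 < ellipse_radius lmin lmax w.
Proof.
move=> l0 lt_l; pose c := (lmin + lmax) / 2; pose h := (lmax - lmin) / 2.
have h0 : 0 < h by rewrite /h; lra.
have hc : h < c by rewrite /h /c; lra.
have -> : lmin = c - h by rewrite /c /h; field.
have -> : lmax = c + h by rewrite /c /h; field.
by case: (ellipse_radius_joukowski w h0 hc).
Qed.

Lemma continuous_ellipse_radius (R : realType) (lmin lmax : R) :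
  continuous (ellipse_radius lmin lmax).
Proof.
have calpha : continuous (ellipse_alpha lmin lmax).
  have -> : ellipse_alpha lmin lmax = fun w =>
      (Num.sqrt (lmin ^+ 2 + w ^+ 2) + Num.sqrt (lmax ^+ 2 + w ^+ 2)) /
      `|lmax - lmin|.
    apply/funext => w; rewrite /ellipse_alpha /= subrr expr0n addr0 sqrtr_sqr.
    by [].
  have cs (a : R) : continuous (fun w : R => Num.sqrt (a ^+ 2 + w ^+ 2)).
    move=> w; apply: (@continuous_comp _ _ _ (fun w : R => a ^+ 2 + w ^+ 2)).
      exact: continuous_sum_sqr.
    exact: sqrt_continuous.
  by move=> w; apply: cvgM; [apply: cvgD; exact: cs|exact: cvg_cst].
move=> w; apply: cvgD; first exact: calpha.
apply: (@continuous_comp _ _ _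
  (fun w : R => ellipse_alpha lmin lmax w ^+ 2 - 1) Num.sqrt).
  apply: cvgB; last exact: cvg_cst.
  apply: (@continuous_comp _ _ _ (ellipse_alpha lmin lmax)
    (fun x : R => x ^+ 2)).
    exact: calpha.
  exact: exprn_continuous.
exact: sqrt_continuous.
Qed.

Lemma measurable_ellipse_weight (R : realType) (lmin lmax : R) :
  0 < lmin -> lmin < lmax ->
  let rho := ellipse_radius lmin lmax in
  measurable_fun setT (fun w => rho w ^+ 2 / (rho w ^+ 2 - 1) ^+ 2) /\
  forall x, measurable_fun setT (fun w => (1 / rho w) `^ x).
Proof.
move=> l0 lt_l rho.
have rho1 w : 1 < rho w by exact: ellipse_radius_gt1.
have crho : continuous rho := @continuous_ellipse_radius R lmin lmax.
have crho2 : continuous (fun w => rho w ^+ 2).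
  move=> w; apply: (@continuous_comp _ _ _ rho (fun x : R => x ^+ 2)).
    exact: crho.
  exact: exprn_continuous.
split.
  apply: continuous_measurable_fun => w; apply: cvgM; first exact: crho2.
  apply: cvgV.
    by rewrite gt_eqF// exprn_gt0// subr_gt0 exprn_egt1.
  apply: (@continuous_comp _ _ _ (fun w : R => rho w ^+ 2 - 1)
    (fun x : R => x ^+ 2)); last exact: exprn_continuous.
  by apply: cvgB; [exact: crho2|exact: cvg_cst].
move=> x; apply: (@measurableT_comp _ _ _ _ _ _ (fun y : R => y `^ x)).
  exact: measurable_powR.
apply: continuous_measurable_fun => w; apply: cvgM; first exact: cvg_cst.
by apply: cvgV; [rewrite gt_eqF// (lt_trans ltr01)|exact: crho].
Qed.

(** * Entries of the shifted inverse as sums over the spectrum *)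

Section ResolventSums.
Context {R : realType} (n : nat).
Local Open Scope complex_scope.
Notation normc := (@ComplexField.Normc.normc R).
Notation mu := (@lebesgue_measure R).
Implicit Types d e f : 'I_n -> R.

(** With [e p = E_p k l] for a spectral resolution of [M], this is the entry
    [(k, l)] of [(M + i w)^-1]. *)
Definition resolvent_sum d e (w : R) : R[i] :=
  \sum_p (e p)%:C / ((d p) +i* w).

Lemma resolvent_sum_mul_conj d e f (w : R) : (forall p, 0 < d p) ->
  complex.Re (resolvent_sum d e w * (resolvent_sum d f w)^*) =
  \sum_p \sum_q e p * f q *
    ((d p * d q + w ^+ 2) / ((d p ^+ 2 + w ^+ 2) * (d q ^+ 2 + w ^+ 2))).
Proof.
move=> d0; rewrite /resolvent_sum rmorph_sum mulr_suml raddf_sum.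
apply: eq_bigr => p _; rewrite mulr_sumr raddf_sum; apply: eq_bigr => q _.
rewrite /=; field.
by rewrite !gt_eqF ?sum_sqr_gt0.
Qed.

Lemma Re_mul_conj_le (x y : R[i]) :
  `|complex.Re (x * y^*)| <= normc x * normc y.
Proof.
have -> : normc x * normc y = normc (x * y^*).
  rewrite ComplexField.Normc.normcM; congr (_ * _).
  by case: y => ? ?; rewrite /= sqrrN.
case: (x * y^*) => a b /=.
by rewrite -sqrtr_sqr ler_wsqrtr// lerDl sqr_ge0.
Qed.

(** The double sum is, up to the factor [2 pi], the integral of the real part of
    [resolvent_sum d e w] times the conjugate of [resolvent_sum d f w], because
    this holds term by term ([integral_resolvent_pair]). The right-hand side may
    be infinite. *)
Lemma sylvester_sum_le_integral d e f (K : R) (g : R -> R) :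
  (forall p, 0 < d p) -> 0 <= K -> (forall w, 0 <= g w) ->
  measurable_fun setT g ->
  (forall w, normc (resolvent_sum d e w) * normc (resolvent_sum d f w) <=
    K * g w) ->
  ((`|\sum_p \sum_q e p * f q / (d p + d q)|)%:E <=
   ((2 * pi)^-1 * K)%:E * \int[mu]_(w in [set: R]) (g w)%:E)%E.
Proof.
move=> d0 K0 g0 mg le_g.
pose H w := complex.Re (resolvent_sum d e w * (resolvent_sum d f w)^*).
have tp0 : 0 < 2 * pi :> R by rewrite mulr_gt0 ?pi_gt0.
have tpV : ((2 * pi)%:E * ((2 * pi)^-1)%:E = 1 :> \bar R)%E.
  by rewrite -EFinM divff// gt_eqF.
have [iH HE] : mu.-integrable setT (fun w => (H w)%:E) /\
    (\int[mu]_w (H w)%:E =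
     (2 * pi * \sum_p \sum_q e p * f q / (d p + d q))%:E)%E.
  pose G p q w := ((e p * f q)%:E * ((d p * d q + w ^+ 2) /
      ((d p ^+ 2 + w ^+ 2) * (d q ^+ 2 + w ^+ 2)))%:E)%E.
  have iG p q : mu.-integrable setT (G p q).
    by apply: integrableZl => //; case: (integral_resolvent_pair (d0 p) (d0 q)).
  have -> : (fun w => (H w)%:E) = (fun w => (\sum_p \sum_q G p q w)%E).
    apply/funext => w; rewrite /H resolvent_sum_mul_conj// -sumEFin.
    by apply: eq_bigr => p _; rewrite -sumEFin.
  have iGp p : mu.-integrable setT (fun w => (\sum_q G p q w)%E).
    exact: integrable_sum.
  split; first exact: integrable_sum.
  rewrite integral_sum// mulr_sumr -sumEFin; apply: eq_bigr => p _.
  rewrite integral_sum// mulr_sumr -sumEFin; apply: eq_bigr => q _.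
  have [ir rE] := integral_resolvent_pair (d0 p) (d0 q).
  by rewrite /G integralZl// rE -EFinM; congr (_%:E); ring.
have mH : measurable_fun setT (fun w => (H w)%:E) by case/integrableP: iH.
have mgE : measurable_fun setT (fun w => (g w)%:E) by exact/measurable_EFinP.
rewrite EFinM -muleA -ge0_integralZl//; last by move=> w _; rewrite lee_fin.
rewrite -(@lee_pmul2l _ (2 * pi)%:E)// ?lte_fin// muleA tpV mul1e.
rewrite -EFinM -{1}(gtr0_norm tp0) -normrM -abse_EFin -HE.
apply: (le_trans (le_abse_integral _ _ _)) => //.
apply: ge0_le_integral => //.
- exact: measurableT_comp.
- by apply: emeasurable_funM.
- move=> w _; rewrite abse_EFin -EFinM lee_fin.
  exact: le_trans (Re_mul_conj_le _ _) (le_g w).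
Qed.

Lemma normc_resolvent_sum_le d e (lmin w : R) : 0 < lmin ->
  (forall p, lmin <= d p) -> \sum_p `|e p| <= 1 ->
  normc (resolvent_sum d e w) <= 1 / Num.sqrt (lmin ^+ 2 + w ^+ 2).
Proof.
move=> l0 ld e1; rewrite -lecR -normcR_def /resolvent_sum.
have s0 : 0 < Num.sqrt (lmin ^+ 2 + w ^+ 2) by rewrite sqrtr_gt0 sum_sqr_gt0.
apply: (le_trans (ler_norm_sum _ _ _)).
apply: (@le_trans _ _
  (\sum_p `|e p|%:C * (1 / Num.sqrt (lmin ^+ 2 + w ^+ 2))%:C)).
  apply: ler_sum => p _.
  rewrite normrM normfV !normcR_def /= expr0n addr0 sqrtr_sqr.
  rewrite -fmorphV -!rmorphM /=.
  rewrite lecR ler_wpM2l// div1r lef_pV2 ?posrE ?sqrtr_gt0 ?sum_sqr_gt0//.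
    by rewrite ler_wsqrtr// lerD2r lerXn2r// nnegrE ltW// (lt_le_trans l0).
  exact: lt_le_trans (ld p).
rewrite -mulr_suml -rmorph_sum -rmorphM lecR ler_piMl// divr_ge0// ltW//.
Qed.

(** The vanishing moments say that the weights [e] annihilate every polynomial of
    degree at most [m], so the polynomial of [resolvent_poly_approx] may be
    subtracted from [1 / (x + i w)] under the sum. *)
Lemma normc_resolvent_sum_le_of_moments d e (c h w rho : R) (m : nat) :
  rho = ellipse_radius (c - h) (c + h) w -> 0 < h -> h < c ->
  (forall p, c - h <= d p <= c + h) ->
  \sum_p `|e p| <= 1 ->
  (forall r, (r <= m)%N -> \sum_p e p * d p ^+ r = 0) ->
  normc (resolvent_sum d e w) <=
    h^-1 * (4 * rho ^+ 2 / (rho ^+ 2 - 1) ^+ 2) / rho ^+ m.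
Proof.
move=> rhoE h0 hc dI e1 mom.
have [rho1 [z [zn zw]]] := ellipse_radius_joukowski w h0 hc.
rewrite -rhoE in rho1 zn.
have hC0 : 0 < h%:C by rewrite ltcR.
have z1 : 1 < `|z| by rewrite zn ltcR.
have [q sq qP] := resolvent_poly_approx c%:C m hC0 z1.
have qmom : \sum_p (e p)%:C * q.[(d p)%:C] = 0.
  under eq_bigr => p _ do rewrite (horner_coef_wide _ sq) mulr_sumr.
  rewrite exchange_big big1//= => r _.
  under eq_bigr => p _ do rewrite mulrCA -rmorphXn -rmorphM.
  by rewrite -mulr_sumr -rmorph_sum mom ?mulr0// -ltnS.
set B := _ / rho ^+ m.
have B0 : 0 <= B.
  have rho0 : 0 < rho by rewrite (lt_trans ltr01).
  rewrite divr_ge0 ?exprn_ge0 ?(ltW rho0)// mulr_ge0 ?invr_ge0 ?(ltW h0)//.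
  by rewrite divr_ge0 ?sqr_ge0// mulr_ge0 ?sqr_ge0.
have BE : h%:C^-1 * (4 * `|z| ^+ 2 / (`|z| ^+ 2 - 1) ^+ 2) * `|z| ^- m = B%:C.
  rewrite zn /B; rewrite !(rmorphM, fmorphV, rmorphXn, rmorphB, rmorph1) /=.
  by rewrite rmorph_nat.
rewrite -lecR -normcR_def -[resolvent_sum _ _ _]subr0 -[X in _ - X]qmom.
rewrite /resolvent_sum -sumrB; apply: (le_trans (ler_norm_sum _ _ _)).
apply: (@le_trans _ _ (\sum_p `|e p|%:C * B%:C)).
  apply: ler_sum => p _; rewrite -mulrBr normrM normcR_def /=.
  rewrite expr0n addr0 sqrtr_sqr ler_wpM2l ?ler0c// -BE.
  have -> : d p +i* w = (d p)%:C - c%:C - h%:C * (z + z^-1) / 2.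
    have -> : (d p)%:C - c%:C - h%:C * (z + z^-1) / 2 =
      (d p)%:C - (c%:C + h%:C * (z + z^-1) / 2) by rewrite opprD addrA.
    by rewrite zw; simpc.
  apply: qP.
  by rewrite -rmorphB -rmorphD !lecR.
by rewrite -mulr_suml -rmorph_sum -rmorphM lecR ler_piMl.
Qed.
End ResolventSums.

(** * Banded matrices and their Kronecker sums *)

Lemma eigenvalue_posdef_gt0 (R : realType) (n : nat) (M : 'M[R]_n) (a : R) :
  posdef M -> eigenvalue M a -> 0 < a.
Proof.
move=> [_ Mpos] /eigenvalueP[v vM v0].
have vT0 : v^T != 0 by rewrite -trmx0 (inj_eq trmx_inj).
have := Mpos _ vT0; rewrite trmxK vM -scalemxAl mxE.
have vv : 0 <= (v *m v^T) 0 0.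
  by rewrite mxE sumr_ge0// => p _; rewrite mxE -expr2 sqr_ge0.
by apply: contraTT; rewrite -!leNgt => a0; rewrite mulr_le0_ge0.
Qed.

Section SpectralSums.
Context {R : realType} {n : nat} (M : 'M[R]_n).
Context (d : 'I_n -> R) (E : 'I_n -> 'M[R]_n).
Context (ME : forall p, M *m E p = d p *: E p) (E1 : \sum_p E p = 1%:M).

(** The sum is the entry [(k, l)] of [M^r], whose bandwidth is [r b]. *)
Lemma banded_moments (b r : nat) (k l : 'I_n) : banded b M ->
  (r * b)%:R < `|k%:R - l%:R : R| -> \sum_p E p k l * d p ^+ r = 0.
Proof.
move=> Mb; elim: r k => [|r IH] k kl.
  under eq_bigr do rewrite expr0 mulr1.
  rewrite -summxE E1 mxE; case: eqP kl => // ->.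
  by rewrite subrr normr0 mul0n ltxx.
have -> : \sum_p E p k l * d p ^+ r.+1 =
    \sum_q M k q * \sum_p E p q l * d p ^+ r.
  under [RHS]eq_bigr do rewrite mulr_sumr.
  rewrite exchange_big; apply: eq_bigr => p _ /=.
  under eq_bigr do rewrite mulrA.
  have /matrixP/(_ k l) := ME p; rewrite !mxE -mulr_suml => ->.
  by rewrite exprS; ring.
apply: big1 => q _.
have [kq|kq] := ltP b%:R `|k%:R - q%:R : R|; first by rewrite Mb ?mul0r.
rewrite IH ?mulr0//.
have := ler_distD (q%:R : R) k%:R l%:R.
by move: kl kq; rewrite mulSn natrD; lra.
Qed.

(** Each [E_p (x) E_q] has its columns in the eigenspace of the Kronecker sum for
    [d_p + d_q], and these matrices sum to the identity. *)
Lemma invmx_kron_sum : (forall p, 0 < d p) ->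
  invmx (kron_sum M) = \sum_p \sum_q (d p + d q)^-1 *: tensmx (E p) (E q).
Proof.
move=> d0; set N := (X in _ = X).
have SN : kron_sum M *m N = 1%:M.
  have -> : kron_sum M *m N = \sum_p \sum_q tensmx (E p) (E q).
    rewrite mulmx_sumr; apply: eq_bigr => p _.
    rewrite mulmx_sumr; apply: eq_bigr => q _.
    rewrite -scalemxAr /kron_sum mulmxDl !tensmx_mul !mul1mx !ME.
    apply/matrixP => i j; rewrite !mxE; field.
    by rewrite gt_eqF// addr_gt0.
  apply/matrixP => i j; rewrite summxE.
  under eq_bigr do rewrite summxE.
  case: (mxtens_indexP i) => i1 i2; case: (mxtens_indexP j) => j1 j2.
  under eq_bigr => p _ do under eq_bigr => q _ do rewrite tensmxE.
  under eq_bigr do rewrite -mulr_sumr -summxE E1.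
  rewrite -mulr_suml -summxE E1 !mxE -natrM mulnb.
  by rewrite (can_eq (@mxtens_indexK n n)).
have [uS _] := mulmx1_unit SN.
by rewrite -[RHS]mul1mx -(mulVmx uS) -mulmxA SN mulmx1.
Qed.
End SpectralSums.

Lemma invmx_kron_sum_entry (R : realType) (n : nat) (M : 'M[R]_n)
    (d : 'I_n -> R) (E : 'I_n -> 'M[R]_n) (k t : 'I_(n * n)) :
  (forall p, M *m E p = d p *: E p) -> \sum_p E p = 1%:M ->
  (forall p, 0 < d p) ->
  invmx (kron_sum M) k t = \sum_p \sum_q
    E p (mxtens_unindex k).1 (mxtens_unindex t).1 *
    E q (mxtens_unindex k).2 (mxtens_unindex t).2 / (d p + d q).
Proof.
move=> ME E1 d0; rewrite (invmx_kron_sum ME E1 d0) summxE.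
apply: eq_bigr => p _; rewrite summxE; apply: eq_bigr => q _.
by rewrite !mxE mulrC.
Qed.

(** The exponent [(D - 1) %/ b] is the largest [r] with [r b < D], that is, one
    less than the quotient [D / b] rounded up. *)
Lemma expVn_le_powR (R : realType) (rho : R) (b D : nat) :
  (0 < b)%N -> (0 < D)%N -> 1 < rho ->
  (rho ^+ (D.-1 %/ b))^-1 <= (1 / rho) `^ (D%:R / b%:R - 1).
Proof.
move=> b0 D0 rho1; have rho0 : 0 < rho by rewrite (lt_trans ltr01).
rewrite div1r -exprVn -powR_mulrn ?invr_ge0 ?(ltW rho0)//.
apply: ger_powR; first by rewrite invr_gt0 rho0 invf_le1// ltW.
rewrite lerBlDr ler_pdivrMr ?ltr0n// natr1 -natrM ler_nat.
by rewrite -[leqLHS](prednK D0) -ltn_divLR.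
Qed.

(** * Decay off the diagonal and the integral bounds *)

(** This is the exponential decay of the entries of [(M + i w)^-1] away from the
    diagonal: the entry has vanishing moments up to the degree
    [(|k - l| - 1) %/ b]. *)
Lemma banded_resolvent_sum_le (R : realType) (n b : nat) (M : 'M[R]_n)
    (lmin lmax : R) (d : 'I_n -> R) (E : 'I_n -> 'M[R]_n) (k l : 'I_n) (w : R) :
  let rho := ellipse_radius lmin lmax w in
  (0 < b)%N -> banded b M -> 0 < lmin -> lmin < lmax ->
  (forall p, M *m E p = d p *: E p) -> \sum_p E p = 1%:M ->
  (forall p, lmin <= d p <= lmax) -> \sum_p `|E p k l| <= 1 -> k != l ->
  ComplexField.Normc.normc (resolvent_sum d (fun p => E p k l) w) <=
    8 / `|lmax - lmin| * (rho ^+ 2 / (rho ^+ 2 - 1) ^+ 2 *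
      (1 / rho) `^ (`|k%:R - l%:R| / b%:R - 1)) :> R.
Proof.
move=> rho b0 Mb l0 lt_l ME E1 dI Ekl kl.
pose c := (lmin + lmax) / 2; pose h := (lmax - lmin) / 2.
have h0 : 0 < h by rewrite /h; lra.
have hc : h < c by rewrite /h /c; lra.
have lminE : lmin = c - h by rewrite /c /h; field.
have lmaxE : lmax = c + h by rewrite /c /h; field.
have rhoE : rho = ellipse_radius (c - h) (c + h) w by rewrite -lminE -lmaxE.
have rho1 : 1 < rho := ellipse_radius_gt1 w l0 lt_l.
(* One of the two truncated differences is zero, so [D] is the distance. *)
pose D := ((k - l) + (l - k))%N.
have D0 : (0 < D)%N.
  by rewrite addn_gt0 !subn_gt0 orbC -neq_ltn.
have DE : `|k%:R - l%:R : R| = D%:R.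
  rewrite /D; case: (leqP k l) => [kl'|/ltnW lk].
    by rewrite distrC -natrB// normr_nat (eqP kl').
  by rewrite -natrB// normr_nat (eqP lk) addn0.
apply: (@le_trans _ _ (h^-1 * (4 * rho ^+ 2 / (rho ^+ 2 - 1) ^+ 2) /
    rho ^+ (D.-1 %/ b))).
  apply: (normc_resolvent_sum_le_of_moments rhoE) => //.
    by move=> p; rewrite -lminE -lmaxE.
  move=> r rD; apply: (banded_moments ME E1 Mb).
  rewrite DE ltr_nat -[D](prednK D0) ltnS.
  by rewrite -leq_divRL.
rewrite DE gtr0_norm ?subr_gt0//.
have -> : h^-1 * (4 * rho ^+ 2 / (rho ^+ 2 - 1) ^+ 2) =
    8 / (lmax - lmin) * (rho ^+ 2 / (rho ^+ 2 - 1) ^+ 2).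
  have u1 : lmax - lmin != 0 by rewrite subr_eq0 gt_eqF.
  have u2 : rho ^+ 2 - 1 != 0 by rewrite subr_eq0 gt_eqF// exprn_egt1.
  by rewrite /h; field; rewrite u1 u2.
rewrite -[leLHS]mulrA ler_wpM2l//.
  by rewrite divr_ge0// subr_ge0 ltW.
rewrite ler_wpM2l ?divr_ge0 ?sqr_ge0//.
exact: expVn_le_powR.
Qed.

Theorem proposition4p1 (R : realType) (n b : nat) (M : 'M[R]_n) (lmin lmax : R)
    (b_ge1 : (1 <= b)%N) (M_pos : posdef M) (M_band : banded b M)
    (lminP : smallest_eigenvalue M lmin) (lmaxP : largest_eigenvalue M lmax)
    (k t : 'I_(n * n)) :
  let Sinv := invmx (kron_sum M) in
  let rho := ellipse_radius lmin lmax in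
  let mu := @lebesgue_measure R in
  let j := block_idx n t.+1 in
  let i := inner_idx n t.+1 in
  let m := block_idx n k.+1 in
  let l := inner_idx n k.+1 in
  let dil : R := `|i%:R - l%:R| in
  let djm : R := `|j%:R - m%:R| in
  [/\ lmin != lmax -> i != l -> j != m ->
      ((`|Sinv k t|)%:E <=
       ((2 * pi)^-1 * (64 / `|lmax - lmin| ^+ 2))%:E *
       \int[mu]_(w in [set: R])
         (((rho w ^+ 2 / (rho w ^+ 2 - 1) ^+ 2) ^+ 2 *
           (1 / rho w) `^ (dil / b%:R + djm / b%:R - 2))%:E))%E,
      lmin != lmax -> (i == l) (+) (j == m) ->
      ((`|Sinv k t|)%:E <=
       ((2 * pi)^-1 * (8 / `|lmax - lmin|))%:E *
       \int[mu]_(w in [set: R])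
         ((1 / Num.sqrt (lmin ^+ 2 + w ^+ 2) *
           (rho w ^+ 2 / (rho w ^+ 2 - 1) ^+ 2) *
           (1 / rho w) `^ (dil / b%:R + djm / b%:R - 1))%:E))%E
    & i = l -> j = m ->
      ((`|Sinv k t|)%:E <=
       ((2 * pi)^-1)%:E *
       \int[mu]_(w in [set: R]) ((1 / (lmin ^+ 2 + w ^+ 2))%:E))%E /\
      (((2 * pi)^-1)%:E *
       \int[mu]_(w in [set: R]) ((1 / (lmin ^+ 2 + w ^+ 2))%:E) =
       (1 / (2 * lmin))%:E)%E].
Proof.
move=> Sinv rho mu j i m l dil djm.
have [[lminE lmin_le] [lmaxE lmax_ge]] := (lminP, lmaxP).
have l0 : 0 < lmin := eigenvalue_posdef_gt0 M_pos lminE.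
have [d [E [dE ME E1 Ele]]] := real_spectral_resolution (proj1 M_pos).
have dge p : lmin <= d p by exact: lmin_le.
have dI p : lmin <= d p <= lmax by rewrite dge lmax_ge.
have d0 p : 0 < d p := lt_le_trans l0 (dge p).
set k1 := (mxtens_unindex k).1; set k2 := (mxtens_unindex k).2.
set t1 := (mxtens_unindex t).1; set t2 := (mxtens_unindex t).2.
have idxE (s : 'I_(n * n)) : block_idx n s.+1 = (mxtens_unindex s).1.+1 /\
    inner_idx n s.+1 = (mxtens_unindex s).2.+1.
  rewrite /block_idx /inner_idx subn1 addn1 /=; split=> //.
  by rewrite {1}(divn_eq s n) mulnC -addnS addKn.
have [mE lE] : m = k1.+1 /\ l = k2.+1 := idxE k.
have [jE iE] : j = t1.+1 /\ i = t2.+1 := idxE t.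
have jm : (j == m) = (k1 == t1) by rewrite jE mE eqSS eq_sym.
have il : (i == l) = (k2 == t2) by rewrite iE lE eqSS eq_sym.
have distS (x y : nat) : `|x.+1%:R - y.+1%:R| = `|y%:R - x%:R| :> R.
  by rewrite distrC -!natr1; congr `|_|; ring.
have djmE : djm = `|k1%:R - t1%:R| by rewrite /djm jE mE distS.
have dilE : dil = `|k2%:R - t2%:R| by rewrite /dil iE lE distS.
(* The moduli of the entries of [(M + i w)^-1] at the block and inner indices. *)
pose x (w : R) : R :=
  ComplexField.Normc.normc (resolvent_sum d (fun p => E p k1 t1) w).
pose y (w : R) : R :=
  ComplexField.Normc.normc (resolvent_sum d (fun p => E p k2 t2) w).
have normc_ge0 (z : R[i]) : 0 <= ComplexField.Normc.normc z.
  by case: z => ? ?; exact: sqrtr_ge0.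
have x_ge0 w : 0 <= x w by exact: normc_ge0.
have y_ge0 w : 0 <= y w by exact: normc_ge0.
have bound (K : R) (g : R -> R) :
    0 <= K -> (forall w, 0 <= g w) -> measurable_fun setT g ->
    (forall w, x w * y w <= K * g w) ->
    ((`|Sinv k t|)%:E <= ((2 * pi)^-1 * K)%:E * \int[mu]_w (g w)%:E)%E.
  move=> K0 g0 mg le_g; rewrite /Sinv (invmx_kron_sum_entry k t ME E1 d0).
  exact: sylvester_sum_le_integral.
have x_diag w : x w <= 1 / Num.sqrt (lmin ^+ 2 + w ^+ 2).
  exact: normc_resolvent_sum_le.
have y_diag w : y w <= 1 / Num.sqrt (lmin ^+ 2 + w ^+ 2).
  exact: normc_resolvent_sum_le.
have s0 w : 0 < Num.sqrt (lmin ^+ 2 + w ^+ 2).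
  by rewrite sqrtr_gt0 sum_sqr_gt0.
pose wt (w : R) : R := rho w ^+ 2 / (rho w ^+ 2 - 1) ^+ 2.
have wt0 w : 0 <= wt w by rewrite divr_ge0 ?sqr_ge0.
have lt_l : lmin != lmax -> lmin < lmax.
  by rewrite lt_neqAle => ->; exact: lmin_le.
have x_off w : lmin != lmax -> k1 != t1 ->
    x w <= 8 / `|lmax - lmin| * (wt w * (1 / rho w) `^ (djm / b%:R - 1)).
  move=> ll kt; rewrite djmE.
  exact: (banded_resolvent_sum_le w b_ge1 M_band l0 (lt_l ll) ME E1 dI).
have y_off w : lmin != lmax -> k2 != t2 ->
    y w <= 8 / `|lmax - lmin| * (wt w * (1 / rho w) `^ (dil / b%:R - 1)).
  move=> ll kt; rewrite dilE.
  exact: (banded_resolvent_sum_le w b_ge1 M_band l0 (lt_l ll) ME E1 dI).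
have rho_gt1 w : lmin != lmax -> 1 < rho w.
  by move=> /lt_l; exact: ellipse_radius_gt1.
have rho_neq0 w : lmin != lmax -> 1 / rho w != 0.
  by move=> /(rho_gt1 w) r1; rewrite div1r invr_eq0 gt_eqF// (lt_trans ltr01).
split.
- move=> ll il' jm'; rewrite il in il'; rewrite jm in jm'.
  have [mwt mpow] := measurable_ellipse_weight l0 (lt_l ll).
  apply: (bound _ (fun w => wt w ^+ 2 *
    (1 / rho w) `^ (dil / b%:R + djm / b%:R - 2))).
  + by rewrite divr_ge0// exprn_ge0.
  + by move=> w; rewrite mulr_ge0 ?powR_ge0 ?sqr_ge0.
  + apply: measurable_funM; last exact: mpow.
    by apply: measurable_funM.
  + move=> w /=.
    apply: (le_trans (ler_pM _ _ (x_off w ll jm') (y_off w ll il'))) => //.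
    have -> : dil / b%:R + djm / b%:R - 2 =
      (djm / b%:R - 1) + (dil / b%:R - 1) by ring.
    rewrite [in leRHS]powRD; last by rewrite (rho_neq0 w ll) implybT.
    rewrite le_eqVlt; apply/orP; left; apply/eqP.
    have := ll; rewrite -subr_eq0 -normr_eq0 distrC => l12.
    by field.
- move=> ll.
  have [mwt mpow] := measurable_ellipse_weight l0 (lt_l ll).
  have msqrt : measurable_fun setT
      (fun w : R => 1 / Num.sqrt (lmin ^+ 2 + w ^+ 2)).
    apply: continuous_measurable_fun => w; apply: cvgM; first exact: cvg_cst.
    apply: cvgV; first by rewrite gt_eqF.
    apply: (@continuous_comp _ _ _ (fun w : R => lmin ^+ 2 + w ^+ 2)).
      exact: continuous_sum_sqr.
    exact: sqrt_continuous.
  move=> ij; apply: (bound _ (fun w => 1 / Num.sqrt (lmin ^+ 2 + w ^+ 2) *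
    wt w * (1 / rho w) `^ (dil / b%:R + djm / b%:R - 1))).
  + by rewrite divr_ge0.
  + by move=> w; rewrite mulr_ge0 ?powR_ge0// mulr_ge0// divr_ge0// ltW.
  + apply: measurable_funM; last exact: mpow.
    by apply: measurable_funM.
  + move=> w /=; have [il'|il'] := eqVneq i l.
      have jm' : k1 != t1 by move: ij; rewrite il' eqxx /= -jm.
      apply: (le_trans (ler_pM _ _ (x_off w ll jm') (y_diag w))) => //.
      have -> : dil = 0 by rewrite /dil il' subrr normr0.
      rewrite mul0r add0r le_eqVlt; apply/orP; left; apply/eqP; ring.
    have jm' : j = m by move: ij; rewrite (negbTE il') /= => /eqP.
    rewrite il in il'.
    apply: (le_trans (ler_pM _ _ (x_diag w) (y_off w ll il'))) => //.
    have -> : djm = 0 by rewrite /djm jm' subrr normr0.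
    rewrite mul0r addr0 le_eqVlt; apply/orP; left; apply/eqP; ring.
- move=> il' jm'.
  have cf : continuous (fun w : R => 1 / (lmin ^+ 2 + w ^+ 2)).
    move=> w; apply: cvgM; first exact: cvg_cst.
    apply: cvgV; last exact: continuous_sum_sqr.
    by rewrite gt_eqF// sum_sqr_gt0.
  split.
    have := bound 1 (fun w => 1 / (lmin ^+ 2 + w ^+ 2)); rewrite mulr1.
    apply=> //.
    + by move=> w; rewrite divr_ge0// ltW// sum_sqr_gt0.
    + exact: continuous_measurable_fun.
    + move=> w /=; apply: (le_trans (ler_pM _ _ (x_diag w) (y_diag w))) => //.
      rewrite [leRHS]mul1r mulf_div mulr1 -expr2 sqr_sqrtr//.
      by rewrite ltW// sum_sqr_gt0.
  under eq_integral => w _.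
    have -> : 1 / (lmin ^+ 2 + w ^+ 2) =
        lmin^-1 * (lmin / (lmin ^+ 2 + w ^+ 2)).
      by rewrite mulKf ?gt_eqF// div1r.
    by rewrite EFinM; over.
  rewrite integralZl//; last exact: integrable_lorentz.
  have pi_neq0 : pi != 0 :> R by rewrite gt_eqF// pi_gt0.
  have lmin_neq0 : lmin != 0 by rewrite gt_eqF.
  rewrite integral_lorentz// -!EFinM; congr (_%:E).
  by move: (@pi R) pi_neq0 => P P0; field; rewrite lmin_neq0 P0.
Qed.
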